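(* Let $f:\mathbb T\to\mathbb T$ and $\varphi_{ij}:\mathbb T\to\mathbb T$, $i,j=1,\dots,N$, be twice continuously differentiable with $\varphi_{ij}(0)=0$ and $\varphi_{ij}'(0)>0$ for all $i,j$. Let $\mathcal F:\mathcal M_1^N\to\mathcal M_1^N$ be the self-consistent transfer operator with diffusive coupling given by these functions and let $G:\mathbb T^N\to\mathbb T^N$, $(G(\boldsymbol x))_i=f\big(x_i+\sum_j\varphi_{ij}(x_j-x_i)\big)$. Assume that the diagonal $\Delta:=\{(x,\dots,x):x\in\mathbb T\}\subset\mathbb T^N$ is an attracting invariant set for $G$, in the sense that there are $\lambda\in(0,1)$, $n_0\in\mathbb N$ and an open set $U\supset\Delta$ with $G(U)\subset U$ and $d(G^{n_0}(\boldsymbol x),\Delta)\le\lambda\, d(\boldsymbol x,\Delta)$ for all $\boldsymbol x\in U$; and assume that $$\max_{x}|f'(x)|\,\Big|1-\sum_j\varphi_{ij}'(0)\Big|<1\qquad\text{for all }i.$$ Then the set of synchronized states $\mathcal S_\Delta$ is stable, i.e. there are $\epsilon>0$ and $R>0$ such that for every $\boldsymbol\mu'\in\mathcal M_1^N$ with $|\operatorname{supp}\boldsymbol\mu'|_\infty<\epsilon$ and $\operatorname{supp}\boldsymbol\mu'\subset B_R(\Delta)$, $$\lim_{n\to\infty}d_W(\mathcal F^n\boldsymbol\mu',\mathcal S_\Delta)=0.$$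
   Context: $\mathbb T=\mathbb R/\mathbb Z$ is the circle; $N\in\mathbb N$; $d$ denotes the distance on $\mathbb T^N$, $d(\boldsymbol x,X)=\inf_{\boldsymbol y\in X}d(\boldsymbol x,\boldsymbol y)$, and $B_R(X)=\{\boldsymbol y\in\mathbb T^N:\inf_{\boldsymbol x\in X}d(\boldsymbol y,\boldsymbol x)<R\}$. $\mathcal M_1$ is the set of Borel probability measures on $\mathbb T$. For a measurable map $T:\mathbb T\to\mathbb T$, its transfer operator is the push-forward $T_*\mu=\mu\circ T^{-1}$. Self-consistent operator with diffusive coupling (interaction functions $h_{ij}(x,y)=\varphi_{ij}(y-x)$): for $\boldsymbol\mu=(\mu_1,\dots,\mu_N)\in\mathcal M_1^N$ put $$F_{\boldsymbol\mu,i}(x)=f\Big(x+\sum_{j=1}^N\int_{\mathbb T}\varphi_{ij}(y-x)\,d\mu_j(y)\Big),\qquad \mathcal F\boldsymbol\mu=\big(F_{\boldsymbol\mu,1*}\mu_1,\dots,F_{\boldsymbol\mu,N*}\mu_N\big).$$ (As throughout, interaction functions $h_{ij}$ are regarded as real-valued, so that the integrals make sense.) Wasserstein distance: for $\mu,\nu\in\mathcal M_1$, $d_W(\mu,\nu)=\sup_{\phi}\int\phi\,d(\mu-\nu)$ over $\phi:\mathbb T\to\mathbb R$ with Lipschitz constant at most $1$; for $\boldsymbol\mu,\boldsymbol\nu\in\mathcal M_1^N$, $d_W(\boldsymbol\mu,\boldsymbol\nu)=\max_i d_W(\mu_i,\nu_i)$; the distance to a set is the infimum of the distances to its elements. Supports: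 $\operatorname{supp}\boldsymbol\mu=\operatorname{supp}\mu_1\times\dots\times\operatorname{supp}\mu_N$ (topological supports), $|\operatorname{supp}\mu_i|=\inf\{|I|: I\text{ an arc with }\operatorname{supp}\mu_i\subset I\}$ where $|I|$ is arc length, and $|\operatorname{supp}\boldsymbol\mu|_\infty=\max_i|\operatorname{supp}\mu_i|$. $\mathcal S_X=\{\boldsymbol\mu\in\mathcal M_1^N:\ \exists\boldsymbol x\in X\text{ with }\mu_i=\delta_{x_i}\ \forall i=1,\dots,N\}$. *)

(* Defs.v *)
From HB Require Import structures.
From mathcomp Require Import all_boot all_order all_algebra.
From mathcomp Require Import ring_quotient.
From mathcomp Require Import all_classical all_reals all_analysis.
From mathcomp Require Import ring lra.

Set Implicit Arguments.
Unset Strict Implicit.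
Unset Printing Implicit Defensive.
Import Order.TTheory GRing.Theory Num.Theory.
Import numFieldNormedType.Exports.
Local Open Scope classical_set_scope.
Local Open Scope quotient_scope.
Local Open Scope ring_scope.

Definition zint (R : realType) : {pred R} := fun t => t \is a Num.int.

Fact zint_zmod_closed (R : realType) : zmod_closed (@zint R).
Proof.
split; first by rewrite unfold_in rpred0.
by move=> x y; rewrite !unfold_in => xZ yZ; exact: rpredB.
Qed.

HB.instance Definition _ (R : realType) :=
  GRing.isZmodClosed.Build R (@zint R) (zint_zmod_closed R).

Definition circle (R : realType) : Type := @Quotient.quot R (@zint R).

HB.instance Definition _ (R : realType) := GRing.Zmodule.on (circle R).
HB.instance Definition _ (R : realType) := EqQuotient.on (circle R).

Definition cpi {R : realType} (t : R) : circle R := \pi_(circle R) t.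

(* The representative of x in [-1/2, 1/2[. *)
Definition centered {R : realType} (x : circle R) : R :=
  repr x - (Num.floor (repr x + 2^-1))%:~R.

Section circle_metric.
Context {R : realType}.
Implicit Types (x y z : circle R) (t : R).

Lemma cpi_surj x : exists t, x = cpi t.
Proof. by exists (repr x); rewrite /cpi reprK. Qed.

Lemma cpiD t u : cpi (t + u) = cpi t + cpi u.
Proof. exact: (@Quotient.pi_add R (@zint R)). Qed.

Lemma cpiN t : cpi (- t) = - cpi t.
Proof. exact: (@Quotient.pi_opp R (@zint R)). Qed.

Lemma cpiB t u : cpi (t - u) = cpi t - cpi u.
Proof. by rewrite cpiD cpiN. Qed.

Lemma cpi_eqP t u : reflect (exists k : int, t - u = k%:~R) (cpi t == cpi u).
Proof.
have := @Quotient.idealrBE R (@zint R) t u.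
by rewrite /cpi => <-; exact: intrP.
Qed.

Lemma cpi0 : cpi (0 : R) = 0.
Proof. by apply: (addrI (cpi 0)); rewrite -cpiD !addr0. Qed.

Lemma cpi_int (k : int) : cpi (k%:~R : R) = 0.
Proof. by rewrite -cpi0; apply/eqP/cpi_eqP; exists k; rewrite subr0. Qed.

Lemma centeredK x : cpi (centered x) = x.
Proof. by rewrite /centered cpiB cpi_int subr0 /cpi reprK. Qed.

Lemma centered_itv x : - 2^-1 <= centered x < 2^-1.
Proof.
rewrite /centered; have /andP[] := floor_itv (repr x + 2^-1).
rewrite intrD => h1 h2; apply/andP; split; lra.
Qed.

(* [`|centered x|] is the least absolute value of a representative of x *)
Lemma centered_min x t : cpi t = x -> `|centered x| <= `|t|.
Proof.
move=> tx; have /eqP/cpi_eqP[k hk] : cpi (centered x) = cpi t.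
  by rewrite centeredK.
have /andP[h1 h2] := centered_itv x.
have [k0|k0] := eqVneq k 0; first by move: hk; rewrite k0 => /eqP; rewrite subr_eq0 => /eqP ->.
have k1 : 1 <= `|k%:~R : R| by rewrite -intr_norm ler1z -gtz0_ge1 normr_gt0.
have c2 : `|centered x| <= 2^-1 by rewrite ler_norml; apply/andP; split; lra.
have : `|centered x - t| <= `|centered x| + `|t| by exact: ler_normB.
rewrite hk; lra.
Qed.

Lemma centered_id t : `|t| < 2^-1 -> centered (cpi t) = t.
Proof.
rewrite ltr_norml => /andP[t1 t2].
have /eqP/cpi_eqP[k hk] : cpi (centered (cpi t)) = cpi t by rewrite centeredK.
have /andP[h1 h2] := centered_itv (cpi t).
have k1 : `|k%:~R : R| < 1 by rewrite -hk ltr_norml; apply/andP; split; lra.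
have k0 : k = 0.
  by apply/eqP; move: k1; rewrite -intr_norm ltrz1 -[1]add0r ltzD1 normr_le0.
by apply/eqP; rewrite -subr_eq0 hk k0.
Qed.

Lemma centered0 : centered (0 : circle R) = 0.
Proof. by rewrite -cpi0 centered_id// normr0 invr_gt0 ltr0n. Qed.

Let dist x y := `|centered (x - y)|.

Let distxx x : dist x x = 0.
Proof. by rewrite /dist subrr centered0 normr0. Qed.

Let dist_eq0 x y : dist x y = 0 -> x = y.
Proof.
move=> /normr0_eq0 h; apply/eqP; rewrite -subr_eq0.
by rewrite -(centeredK (x - y)) h cpi0.
Qed.

Let dist_sym x y : dist x y = dist y x.
Proof.
suff h u v : dist u v <= dist v u by apply/eqP; rewrite eq_le !h.
rewrite {2}/dist -normrN; apply: centered_min.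
by rewrite cpiN centeredK opprB.
Qed.

Let dist_triangle y x z : dist x z <= dist x y + dist y z.
Proof.
apply: (le_trans _ (ler_normD _ _)); apply: centered_min.
by rewrite cpiD !centeredK addrA subrK.
Qed.

HB.instance Definition _ := isMetric.Build R (circle R)
  distxx dist_eq0 dist_sym dist_triangle.
HB.instance Definition _ := isPointed.Build (circle R) 0.

Lemma mdist_circleE x y : mdist x y = `|centered (x - y)|.
Proof. by []. Qed.

End circle_metric.

HB.instance Definition _ (R : realType) :=
  Measurable.copy (circle R) (g_sigma_algebraType (@open (circle R))).

Notation torus R N := 'rV[circle R]_N.
Notation prob R := (probability (circle R) R).

Section calculus.
Context {R : realType}.

Definition C2 (g : R -> R) : Prop :=
  [/\ forall t, derivable g t 1, forall t, derivable (derive1 g) t 1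
    & continuous (derive1 (derive1 g) : R -> R)].

(* Maps T -> R are differentiated through their 1-periodic lift, maps T -> T
   through a lift R -> R along the covering [cpi]. *)
Definition C2_real (phi : circle R -> R) : Prop := C2 (phi \o cpi).

Definition C2_circle (f : circle R -> circle R) : Prop :=
  exists2 g : R -> R, C2 g & forall t, f (cpi t) = cpi (g t).

Definition deriv_real (phi : circle R -> R) (x : circle R) : R :=
  derive1 (fun t => phi (x + cpi t)) 0.

(* derivative of f read in the charts [centered (_ - x)], [centered (_ - f x)] *)
Definition deriv_circle (f : circle R -> circle R) (x : circle R) : R :=
  derive1 (fun t => centered (f (x + cpi t) - f x)) 0.

Lemma C2_continuous (g : R -> R) : C2 g -> continuous g.
Proof.
by case=> dg _ _ t; apply: differentiable_continuous; exact/derivable1_diffP.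
Qed.

(* With respect to any lift, [deriv_circle f] is the usual derivative. *)
Lemma deriv_circle_lift (f : circle R -> circle R) (g : R -> R) (t : R) :
  C2 g -> (forall s, f (cpi s) = cpi (g s)) ->
  deriv_circle f (cpi t) = derive1 g t.
Proof.
move=> gC2 fg; have gc := C2_continuous gC2.
have [/(_ t) dg _ _] := gC2.
have small : \forall s \near (0 : R), `|g (s + t) - g t| < 2^-1.
  have gt : g (s + t) @[s --> (0 : R)] --> g t.
    have st : s + t @[s --> (0 : R)] --> t.
      by rewrite -[X in _ --> X]add0r; apply: cvgD; [exact: cvg_id|exact: cvg_cst].
    exact: (cvg_comp _ g st (gc t)).
  have : 0 < 2^-1 :> R by rewrite invr_gt0 ltr0n.
  by move/cvgrPdist_lt : gt => /[apply]; apply: filterS => s; rewrite distrC.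
have {}small := nbhs_dnbhs small.
rewrite /deriv_circle /derive1; apply: cvg_lim => //.
have dg' : h^-1 *: (g (h + t) - g t) @[h --> 0^'] --> derive1 g t.
  have E : (fun h : R => h^-1 *: ((g \o shift t) (h *: 1) - g t)) =
      (fun h => h^-1 *: (g (h + t) - g t)).
    by apply/funext => h /=; rewrite [h *: 1]mulr1.
  by move: dg; rewrite /derivable E.
apply: cvg_trans dg'; apply: near_eq_cvg.
apply: filterS small => s hs; rewrite addr0 !cpi0 addr0 subrr.
have -> : centered (0 : circle R) = 0 by rewrite centered0.
by rewrite -cpiD !fg -cpiB [t + s]addrC centered_id ?subr0.
Qed.

Lemma C2_real_lipschitz (phi : circle R -> R) : C2_real phi ->
  exists2 M : R, 0 <= M & forall x y, `|phi x - phi y| <= M * mdist x y.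
Proof.
set p := phi \o cpi; move=> [dp ddp _].
have cp : continuous (derive1 p : R -> R).
  by move=> t; apply: differentiable_continuous; exact/derivable1_diffP.
have [||c _ cM] := @EVT_max R (fun t => `|derive1 p t|) (-1) 1.
- lra.
- apply: continuous_subspaceT => t.
  by apply: (@continuous_comp _ _ _ (derive1 p) Num.norm);
    [exact: cp|exact: norm_continuous].
exists `|derive1 p c| => // x y.
have key (a b : R) : -1 <= a -> a <= b -> b <= 1 ->
    `|p b - p a| <= `|derive1 p c| * (b - a).
  move=> a1 ab b1; have [||s sab ->] := @MVT_segment R p (derive1 p) a b ab.
  - move=> t _; rewrite derive1E; exact/derivableP.
  - apply: continuous_subspaceT => t.
    by apply: differentiable_continuous; exact/derivable1_diffP.
  rewrite normrM (ger0_norm (x := b - a)) ?subr_ge0// ler_wpM2r ?subr_ge0//.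
  apply: cM; move: sab; rewrite !in_itv/= => /andP[h1 h2].
  by rewrite (le_trans a1)// (le_trans h2).
have px : phi x = p (centered y + centered (x - y)).
  by rewrite /p/= cpiD !centeredK addrC subrK.
have py : phi y = p (centered y) by rewrite /p/= centeredK.
rewrite px py mdist_circleE.
have /andP[y1 y2] := centered_itv y; have /andP[d1 d2] := centered_itv (x - y).
have [d0|d0] := leP 0 (centered (x - y)).
- rewrite (ger0_norm d0).
  have K := key (centered y) (centered y + centered (x - y)).
  have e : centered y + centered (x - y) - centered y = centered (x - y).
    by rewrite addrAC subrr add0r.
  by rewrite e in K; apply: K; lra.
- rewrite (ltr0_norm d0).
  have K := key (centered y + centered (x - y)) (centered y).
  have e : centered y - (centered y + centered (x - y)) = - centered (x - y).
    by rewrite opprD addrA subrr add0r.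
  by rewrite e in K; rewrite distrC; apply: K; lra.
Qed.

Lemma cpi_dist (t u : R) : mdist (cpi t) (cpi u) <= `|t - u|.
Proof. by rewrite mdist_circleE; apply: centered_min; rewrite cpiB. Qed.

Lemma cpi_continuous : continuous (@cpi R).
Proof.
move=> t; apply/metricType_numDomainType.cvgrPdist_lt => e e0.
have : t @[t --> t] --> t by exact: cvg_id.
move=> /cvgrPdist_lt/(_ _ e0); apply: filterS => u.
exact/le_lt_trans/cpi_dist.
Qed.

Lemma C2_circle_continuous (f : circle R -> circle R) :
  C2_circle f -> continuous f.
Proof.
move=> [g gC2 fg] x.
apply/(@metricType_numDomainType.cvgrPdist_lt _ _ _ _ (nbhs_filter x)) => e e0.
have /cvgrPdist_lt/(_ _ e0) : g @ centered x --> g (centered x).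
  exact: C2_continuous.
move=> /nbhs_ballP[d /= d0 dP]; apply/nbhs_ballP; exists d => //= y.
rewrite ballEmdist/= mdist_circleE => xy.
have := dP (centered x - centered (x - y)).
rewrite /ball/= opprB addrCA subrr addr0 => /(_ xy) h.
rewrite -{1}(centeredK x) -(subKr x y) -{2}(centeredK x).
rewrite -[X in mdist _ (f (_ - X))]centeredK -cpiB !fg.
by rewrite (le_lt_trans (cpi_dist _ _)).
Qed.

Lemma circle_continuous_measurable (f : circle R -> circle R) :
  continuous f -> measurable_fun setT f.
Proof.
move=> cf; apply: (measurability (@open (circle R))) => //.
move=> _ [U oU <-]; rewrite setTI; apply: sub_sigma_algebra.
by move/continuousP: cf; exact.
Qed.

Lemma circle_continuous_measurable_real (f : circle R -> R) :
  continuous f -> measurable_fun setT f.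
Proof.
move=> /continuousP cf; apply: (measurability _ (measurable_realfun.RGenOpens.measurableE R)).
move=> _ [_ [a [b ->] <-]]; rewrite setTI; apply: sub_sigma_algebra.
exact/cf/interval_open.
Qed.

Lemma mdist_circleD (x y u v : circle R) :
  mdist (x + u) (y + v) <= mdist x y + mdist u v.
Proof.
rewrite !mdist_circleE; apply: (le_trans _ (ler_normD _ _)).
by apply: centered_min; rewrite cpiD !centeredK opprD addrACA.
Qed.

Lemma mdist_circle_le1 (x y : circle R) : mdist x y <= 1.
Proof.
rewrite mdist_circleE; have /andP[h1 h2] := centered_itv (x - y).
by rewrite ler_norml; apply/andP; split; lra.
Qed.

Lemma lipschitz_circle_continuous (M : R) (h : circle R -> R) : 0 <= M ->
  (forall x y, `|h x - h y| <= M * mdist x y) -> continuous h.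
Proof.
move=> M0 hM x; apply/(@cvgrPdist_lt _ _ _ _ (nbhs_filter x)) => e e0.
have M1 : 0 < M + 1 by lra.
apply/nbhs_ballP; exists (e / (M + 1)); first by rewrite /= divr_gt0.
move=> y; rewrite ballEmdist/= => xy; rewrite (le_lt_trans (hM _ _))//.
have := xy; rewrite ltr_pdivlMr// => xy'.
have := metric_structure.mdist_ge0 x y; nra.
Qed.

End calculus.

Section distances.
Context {R : realType}.

(* The flat (Euclidean) distance on the torus; the topology on [torus R N] used
   by [open] is the library's one on matrices, i.e., the product topology. *)
Definition tdist N (x y : torus R N) : R :=
  Num.sqrt (\sum_(i < N) mdist (x 0 i) (y 0 i) ^+ 2).

Definition tdist_set N (x : torus R N) (X : set (torus R N)) : R :=
  inf [set tdist x y | y in X].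

Definition nbhd N (r : R) (X : set (torus R N)) : set (torus R N) :=
  [set y | tdist_set y X < r].

Definition lip1 (phi : circle R -> R) : Prop :=
  forall x y, `|phi x - phi y| <= mdist x y.

Definition dW (mu nu : prob R) : R :=
  sup [set (\int[mu]_x phi x - \int[nu]_x phi x)%R | phi in lip1].

(* The default value 0 of the maximum is only relevant when N = 0. *)
Definition dWmax N (mu nu : 'I_N -> prob R) : R :=
  \big[Num.max/0]_(i < N) dW (mu i) (nu i).

Definition dWmax_set N (mu : 'I_N -> prob R) (S : set ('I_N -> prob R)) : R :=
  inf [set dWmax mu nu | nu in S].

End distances.

Section supports.
Context {R : realType}.

Definition msupp (mu : prob R) : set (circle R) :=
  [set x | forall U : set (circle R), open U -> U x -> (0 < mu U)%E].

Definition msupp_prod N (mu : 'I_N -> prob R) : set (torus R N) :=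
  [set x | forall i, msupp (mu i) (x 0 i)].

(* For 0 <= l <= 1, an arc of length l. *)
Definition circle_arc (a l : R) : set (circle R) := [set cpi t | t in `[a, a + l]].

Definition supp_length (mu : prob R) : R :=
  inf [set l | 0 <= l <= 1 /\ exists a, msupp mu `<=` circle_arc a l].

Definition supp_length_max N (mu : 'I_N -> prob R) : R :=
  \big[Num.max/0]_(i < N) supp_length (mu i).

End supports.

Section dynamics.
Context {R : realType}.

(* T_* mu, with the junk value mu when T is not measurable. *)
Definition transfer (T : circle R -> circle R) (mu : prob R) : prob R :=
  match pselect (measurable_fun setT T) with
  | left mT => distribution mu (mfun_Sub (mem_set mT))
  | right _ => mu
  end.

Lemma transferE (T : circle R -> circle R) (mu : prob R) (A : set (circle R)) :
  measurable_fun setT T -> transfer T mu A = mu (T @^-1` A).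
Proof. by move=> mT; rewrite /transfer; case: pselect. Qed.

Context {N : nat}.
Variables (f : circle R -> circle R) (phi : 'I_N -> 'I_N -> circle R -> R).

Definition mean_field_map (mu : 'I_N -> prob R) (i : 'I_N) (x : circle R) :
    circle R :=
  f (x + cpi (\sum_(j < N) (\int[mu j]_y phi i j (y - x))%R)).

Definition self_consistent_op (mu : 'I_N -> prob R) : 'I_N -> prob R :=
  fun i => transfer (mean_field_map mu i) (mu i).

Definition coupled_map (x : torus R N) : torus R N :=
  \row_i f (x 0 i + cpi (\sum_(j < N) phi i j (x 0 j - x 0 i))).

(* [self_consistent_op] never uses the junk value of [transfer]. *)
Lemma measurable_mean_field_map (mu : 'I_N -> prob R) (i : 'I_N) :
  C2_circle f -> (forall i j, C2_real (phi i j)) ->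
  measurable_fun setT (mean_field_map mu i).
Proof.
move=> fC2 phiC2; apply: circle_continuous_measurable.
pose I j z := (\int[mu j]_y phi i j (y - z))%R.
have Icont j : continuous (I j).
  have [M M0 phiM] := C2_real_lipschitz (phiC2 i j).
  have Iint z : (mu j).-integrable setT (EFin \o (fun y => phi i j (y - z))).
    apply: measurable_bounded_integrable => //.
    - by rewrite (le_lt_trans (probability_le1 _ _))// ltry.
    - apply: circle_continuous_measurable_real.
      apply: (lipschitz_circle_continuous M0) => y w.
      by rewrite (le_trans (phiM _ _))// !mdist_circleE opprB addrA subrK.
    - exists (`|phi i j 0| + M); split; first exact: num_real.
      move=> r hr y _; apply: le_trans (ltW hr) => /=.
      rewrite -[phi i j (y - z)](subrK (phi i j 0)) (le_trans (ler_normD _ _))//.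
      rewrite addrC lerD2l (le_trans (phiM _ _))//.
      by rewrite ler_piMr// mdist_circle_le1.
  apply: (lipschitz_circle_continuous M0) => z w; rewrite /I -RintegralB//.
  have ID : (mu j).-integrable setT
      (EFin \o (fun y => phi i j (y - z) - phi i j (y - w))).
    exact: (integrableB _ (Iint z) (Iint w)).
  apply: (le_trans (le_normr_Rintegral _ _)) => //.
  have -> : M * mdist z w = (\int[mu j]_(y in setT) (M * mdist z w))%R.
    by rewrite Rintegral_cst// [X in fine X](probability_setT (mu j)) mulr1.
  apply: le_Rintegral => //.
  - exact: (integrable_norm ID).
  - exact: (finite_measure_integrable_cst (mu j) _ measurableT).
  - move=> y _ /=; apply: le_trans (phiM _ _) _; rewrite !mdist_circleE.
    rewrite opprB addrC addrA subrK -!mdist_circleE.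
    by rewrite ler_wpM2l// [leLHS]metric_sym.
have Scont : continuous (fun z => \sum_(j < N) I j z).
  by apply: continuous_big => [|j _]; [exact: add_continuous|exact: Icont].
move=> z; apply: (@continuous_comp _ _ _
  (fun z => z + cpi (\sum_(j < N) I j z)) f); last exact: C2_circle_continuous.
apply/(@metricType_numDomainType.cvgrPdist_lt _ _ _ _ (nbhs_filter z)) => e e0.
have e2 : 0 < e / 2 by rewrite divr_gt0.
have /cvgrPdist_lt/(_ _ e2) := Scont z.
have : nbhs z (ball z (e / 2)) by exact: nbhsx_ballx.
apply: filterS2 => w; rewrite ballEmdist/= => zw hw.
rewrite (le_lt_trans (mdist_circleD _ _ _ _))//.
by rewrite [e]splitr ltrD// (le_lt_trans (cpi_dist _ _)).
Qed.

End dynamics.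

Definition sync_diag (R : realType) (N : nat) : set (torus R N) :=
  [set x | exists c : circle R, forall i, x 0 i = c].

Arguments sync_diag R N : clear implicits.

Definition attracting (R : realType) N (G : torus R N -> torus R N)
    (X : set (torus R N)) : Prop :=
  exists (lam : R) (n0 : nat) (U : set (torus R N)),
    [/\ 0 < lam < 1, open U, X `<=` U, G @` U `<=` U
      & forall x, U x -> tdist_set (iter n0 G x) X <= lam * tdist_set x X].

(* Equality of measures is equality on measurable sets. *)
Definition dirac_states (R : realType) N (X : set (torus R N)) :
    set ('I_N -> prob R) :=
  [set mu | exists2 x, X x &
    forall i (A : set (circle R)), measurable A -> mu i A = \d_(x 0 i) A].

Definition stable (R : realType) N
    (F : ('I_N -> prob R) -> 'I_N -> prob R) (X : set (torus R N)) : Prop :=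
  exists eps r : R, [/\ 0 < eps, 0 < r
    & forall mu : 'I_N -> prob R,
        supp_length_max mu < eps -> msupp_prod mu `<=` nbhd r X ->
        (fun n => dWmax_set (iter n F mu) (dirac_states X)) @ \oo --> (0 : R)].

(* Main.v *)
(* Suppose that each mu_i is carried by the ball of radius l around x_i.  Then
   x'_i := F_{mu,i}(x_i) is O(l)-close to G(x)_i, and when l is small and x is
   near the diagonal, F_{mu,i} is a contraction on that ball, since its slope
   there is close to f' * (1 - sum_j phi_ij'(0)).  So the centers follow a
   pseudo-orbit of G whose error is proportional to a shrinking radius.  The
   attraction of the diagonal yields a Lyapunov function V for G, comparable to
   the distance to the diagonal, and V + B * l decays geometrically for B large;
   it bounds the Wasserstein distance to the Dirac masses at (x_0, ..., x_0). *)
Require Import Defs.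
From mathcomp Require Import all_boot all_order all_algebra.
From mathcomp Require Import all_classical all_reals all_analysis.
From mathcomp Require Import ring lra.
Import Order.TTheory GRing.Theory Num.Theory.
Import numFieldNormedType.Exports.
Local Open Scope classical_set_scope.
Local Open Scope ring_scope.

(** * Lipschitz and linearization bounds on the circle *)

Section circle_calculus.
Context {R : realType}.
Implicit Types (x y : circle R).

(** The mean value theorem with the derivative compared to [c]: the choice [c = 0] gives Lipschitz
    bounds, and [c] the derivative at 0 gives a linearization. The interval of the hypothesis is
    symmetric, so the order of [a] and [b] does not matter. *)
Lemma mean_value_bound (g : R -> R) (c k a b : R) :
  (forall t, derivable g t 1) ->
  (forall t, `|t| <= Num.max `|a| `|b| -> `|derive1 g t - c| <= k) ->
  `|g b - g a - c * (b - a)| <= k * `|b - a|.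
Proof.
move=> dg.
have key u v : u <= v ->
    (forall t, `|t| <= Num.max `|u| `|v| -> `|derive1 g t - c| <= k) ->
    `|g v - g u - c * (v - u)| <= k * `|v - u|.
  move=> uv gk; have [||s suv ->] := @MVT_segment R g (derive1 g) u v uv.
  - move=> t _; rewrite derive1E; exact/derivableP.
  - apply: continuous_subspaceT => t.
    by apply: differentiable_continuous; exact/derivable1_diffP.
  rewrite -mulrBl normrM ler_wpM2r//; apply: gk.
  move: suv; rewrite in_itv/= => /andP[us sv].
  rewrite le_max !ler_norml; have [s0|s0] := leP 0 s.
  - apply/orP; right; rewrite (ger0_norm (x := v)) ?(le_trans s0 sv)//.
    by apply/andP; split; lra.
  - have u0 : u < 0 by exact: le_lt_trans s0.
    apply/orP; left; rewrite (ltr0_norm u0) opprK us/=; lra.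
have [ab|/ltW ba] := leP a b; first exact: key.
rewrite maxC => gk; have := key b a ba gk.
have -> : g a - g b - c * (a - b) = - (g b - g a - c * (b - a)) by ring.
by rewrite normrN (distrC a b).
Qed.

(** Compactness of [[-1, 1]], which contains all centered representatives. The bound makes the [sup]
    of the contraction hypothesis a true upper bound rather than a default value. *)
Lemma deriv_circle_bounded (f : circle R -> circle R) : C2_circle f ->
  has_ubound (range (fun x => `|deriv_circle f x|)).
Proof.
move=> [g gC2 fg]; have [dg ddg _] := gC2.
have [||m _ mM] := @EVT_max R (fun t => `|derive1 g t|) (-1) 1.
- lra.
- apply: continuous_subspaceT => t.
  apply: (@continuous_comp _ _ _ (derive1 g) Num.norm); last exact: norm_continuous.
  by apply: differentiable_continuous; exact/derivable1_diffP.
exists `|derive1 g m| => _ [x _ <-].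
rewrite -(centeredK x) (deriv_circle_lift _ gC2)//; apply: mM.
by have /andP[h1 h2] := centered_itv x; rewrite in_itv/=; apply/andP; split; lra.
Qed.

(** The shortest segment from [y] to [x] lifts to the line, where the mean value bound applies to
    the lift of [f]. *)
Lemma C2_circle_lipschitz (f : circle R -> circle R) : C2_circle f ->
  forall x y, mdist (f x) (f y) <=
    sup (range (fun x => `|deriv_circle f x|)) * mdist x y.
Proof.
move=> fC2 x y; have fb := deriv_circle_bounded f fC2.
case: fC2 => g gC2 fg; have [dg _ _] := gC2.
set L := sup _.
have gL (t : R) : `|derive1 g t - 0| <= L.
  rewrite subr0 -(deriv_circle_lift t gC2 fg).
  by apply: (ub_le_sup fb); exists (cpi t).
rewrite [in leRHS]mdist_circleE; set h := centered (x - y); set t := centered y.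
have -> : x = cpi (t + h) by rewrite cpiD !centeredK addrC subrK.
have -> : y = cpi t by rewrite centeredK.
rewrite !fg; apply: le_trans (cpi_dist _ _) _.
have := mean_value_bound g 0 L t (t + h) dg (fun t _ => gL t).
have -> : t + h - t = h by ring.
by rewrite mul0r subr0.
Qed.

Lemma sup_deriv_circle_ge0 (f : circle R -> circle R) : C2_circle f ->
  0 <= sup (range (fun x => `|deriv_circle f x|)).
Proof.
move=> fC2; apply: le_trans (normr_ge0 (deriv_circle f 0)) _.
by apply: ub_le_sup; [exact: deriv_circle_bounded|exists 0].
Qed.

Lemma deriv_real0 (p : circle R -> R) : deriv_real p 0 = derive1 (p \o cpi) 0.
Proof.
by rewrite /deriv_real; congr (derive1 _ _); apply/funext => t; rewrite add0r.
Qed.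

(** Continuity of the derivative at 0. Since the bound holds for all small [e], a single [e] can
    later serve all pairs [i], [j] by intersecting filters. *)
Lemma C2_real_near0 (p : circle R -> R) (k : R) : C2_real p -> 0 < k ->
  \forall e \near 0^'+, forall a b : R, `|a| <= e -> `|b| <= e ->
    `|p (cpi b) - p (cpi a) - deriv_real p 0 * (b - a)| <= k * `|b - a|.
Proof.
move=> [dp ddp _] k0; rewrite deriv_real0.
have cp : continuous (derive1 (p \o cpi) : R -> R).
  by move=> t; apply: differentiable_continuous; exact/derivable1_diffP.
have /cvgrPdist_le/(_ _ k0)/nbhs_ballP[d /= d0 dP] := cp 0.
near=> e => a b ae be.
apply: (mean_value_bound (p \o cpi)) => // t tab; rewrite distrC; apply: dP.
rewrite /ball/= sub0r normrN (le_lt_trans tab)// gt_max.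
by rewrite (le_lt_trans ae) ?(le_lt_trans be)//; near: e; exact: nbhs_right_lt.
Unshelve. all: by end_near. Qed.

End circle_calculus.

(** * Integrals and supports of measures on the circle *)

Section circle_measures.
Context {R : realType}.
Implicit Types (x y z c : circle R) (mu : prob R).

Definition cball x (l : R) : set (circle R) := [set y | mdist x y <= l].

Lemma mdist_lipschitz x y z : `|mdist x y - mdist x z| <= 1 * mdist y z.
Proof.
rewrite mul1r ler_norml; apply/andP; split.
- by have := metric_triangle x y z; lra.
- by have := metric_triangle x z y; rewrite (metric_sym z y); lra.
Qed.

Lemma measurable_mdist x : measurable_fun setT (mdist x).
Proof.
apply: circle_continuous_measurable_real.
exact: (lipschitz_circle_continuous ler01 (mdist_lipschitz x)).
Qed.

Lemma measurable_cball x l : measurable (cball x l).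
Proof.
have -> : cball x l = setT `&` mdist x @^-1` `]-oo, l].
  by rewrite setTI; apply/seteqP; split => y /=; rewrite in_itv.
exact: (measurable_mdist x measurableT).
Qed.

Lemma measurable_circle_ball x (e : R) : measurable (ball x e).
Proof.
have -> : ball x e = setT `&` mdist x @^-1` `]-oo, e[.
  by rewrite setTI ballEmdist; apply/seteqP; split => y /=; rewrite in_itv.
exact: (measurable_mdist x measurableT).
Qed.

Lemma lipschitz_integrable mu (M : R) (h : circle R -> R) : 0 <= M ->
  (forall x y, `|h x - h y| <= M * mdist x y) ->
  mu.-integrable setT (EFin \o h).
Proof.
move=> M0 hM; apply: measurable_bounded_integrable => //.
- by rewrite (le_lt_trans (probability_le1 _ _))// ltry.
- apply: circle_continuous_measurable_real.
  exact: (lipschitz_circle_continuous M0).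
- exists (`|h 0| + M); split; first exact: num_real.
  move=> r hr y _; apply: le_trans (ltW hr) => /=.
  rewrite -[h y](subrK (h 0)) (le_trans (ler_normD _ _))//.
  rewrite addrC lerD2l (le_trans (hM _ _))//.
  by rewrite ler_piMr// mdist_circle_le1.
Qed.

(** The complement of [A] is null, so only the values of [h] on [A] contribute, and [a] is its own
    integral over [A]. *)
Lemma Rintegral_near mu (A : set (circle R)) (h : circle R -> R) (a b : R) :
  measurable A -> mu A = 1%E -> mu.-integrable setT (EFin \o h) ->
  (forall y, A y -> `|h y - a| <= b) ->
  `|\int[mu]_y h y - a| <= b.
Proof.
move=> mA muA ih hA.
have muAC : mu (~` A) = 0%E by rewrite probability_setC// muA subee.
have ihA : mu.-integrable A (EFin \o h).
  exact: (integrableS measurableT mA (@subsetT _ A) ih).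
have ic r : mu.-integrable A (EFin \o cst r).
  exact: finite_measure_integrable_cst.
have cA r : \int[mu]_(y in A) r = r.
  by rewrite Rintegral_cst// [X in fine X]muA mulr1.
have -> : \int[mu]_y h y = \int[mu]_(y in A) h y.
  rewrite /Rintegral (negligible_integral (measurableC mA) measurableT ih muAC).
  by rewrite setTD setCK.
rewrite -{1}(cA a) -RintegralB//; last exact: ic.
have ihB : mu.-integrable A (EFin \o (fun y => h y - a)).
  exact: (integrableB _ ihA (ic a)).
rewrite (le_trans (le_normr_Rintegral _ _))// -[leRHS]cA.
by apply: le_Rintegral => //; [exact: (integrable_norm ihB)|exact: ic].
Qed.

(** Second countability: the null balls among those with rational centers and radii [1/(k+1)] cover
    the complement of the support. *)
Lemma negligible_msuppC mu : mu.-negligible (~` msupp mu).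
Proof.
pose B (qk : rat * nat) : set (circle R) :=
  ball (cpi (ratr qk.1 : R)) (qk.2.+1%:R^-1).
(* The family is indexed by [nat] through [unpickle]; codes of no pair and balls of positive mass
   contribute the empty set. *)
pose F (n : nat) : set (circle R) := if @unpickle (rat * nat)%type n is Some qk then
  if mu (B qk) == 0%E then B qk else set0 else set0.
have mB qk : measurable (B qk) by exact: measurable_circle_ball.
have negF n : mu.-negligible (F n).
  rewrite /F; case: unpickle => [qk|]; last exact: negligible_set0.
  by case: eqP => [B0|_]; [exact/negligibleP|exact: negligible_set0].
apply: (negligibleS _ (negligible_bigcup negF)) => x /=.
move=> /existsNP[U /not_implyP[oU /not_implyP[Ux /negP]]]; rewrite -leNgt => U0.
have /nbhs_ballP[e /= e0 eU] : nbhs x U by exact: open_nbhs_nbhs.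
have mU : measurable U by exact: sub_sigma_algebra.
(* With [2 * d < e], a ball of radius [d] whose center is within [d] of [x] stays inside [U]. *)
have [k [d [kd d0 de]]] : exists (k : nat) (d : R),
    [/\ k.+1%:R^-1 = d, 0 < d & 2 * d < e].
  exists (Num.trunc (e^-1 * 2)), (Num.trunc (e^-1 * 2)).+1%:R^-1.
  split; rewrite ?invr_gt0// ltr_pdivrMr// -ltr_pdivrMl//.
  exact: truncnS_gt.
have [q /andP[q1 q2]] : exists q : rat, centered x - d < ratr q < centered x + d.
  have [|q] := @rat_in_itvoo R (centered x - d) (centered x + d); first by lra.
  by rewrite in_itv/= => ?; exists q.
have qx : mdist (cpi (ratr q)) x < d.
  rewrite -{1}(centeredK x) (le_lt_trans (cpi_dist _ _))// ltr_norml.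
  by apply/andP; split; lra.
have BU : B (q, k) `<=` U.
  move=> y; rewrite /B/= kd ballEmdist/= => qy; apply: eU; rewrite ballEmdist/=.
  have := metric_triangle x (cpi (ratr q)) y; rewrite (metric_sym x (cpi _)); lra.
have B0 : (mu (B (q, k)) == 0)%E.
  by rewrite -measure_le0 (le_trans _ U0)// le_measure// inE.
exists (pickle (q, k)); first exact: I.
rewrite /F pickleK B0.
by rewrite /B/= kd ballEmdist.
Qed.

Lemma msupp_full mu (A : set (circle R)) :
  measurable A -> msupp mu `<=` A -> mu A = 1%E.
Proof.
move=> mA suppA; have mAC : measurable (~` A) by exact: measurableC.
have : mu (~` A) = 0%E.
  apply/(negligibleP mu mAC).
  by apply: (negligibleS _ (negligible_msuppC mu)); exact: subsetC.
move=> AC0; rewrite -[A]setCK probability_setC//.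
by rewrite [X in (1 - X)%E]AC0 sube0.
Qed.

Lemma msupp_nonempty mu : msupp mu !=set0.
Proof.
apply/set0P/negP => /eqP supp0.
have := @msupp_full mu set0 measurable0; rewrite supp0 => /(_ (@subset_refl _ _)).
by rewrite measure0 => /eqP; rewrite eq_sym onee_eq0.
Qed.

End circle_measures.

(** * Distance to the diagonal and a Lyapunov function for the coupled map *)

Section torus_spread.
Context {R : realType}.

(** Replaces the Euclidean [tdist], so that coordinatewise estimates add up without square roots. *)
Definition l1dist {N} (x y : torus R N) : R := \sum_i mdist (x 0 i) (y 0 i).

Lemma l1dist_ge0 N (x y : torus R N) : 0 <= l1dist x y.
Proof. by apply: sumr_ge0 => i _; exact: mdist_ge0. Qed.

Lemma mdist_le_l1dist N (x y : torus R N) i : mdist (x 0 i) (y 0 i) <= l1dist x y.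
Proof.
rewrite /l1dist (bigD1 i)//= lerDl; apply: sumr_ge0 => j _; exact: mdist_ge0.
Qed.

Lemma tdist_le_l1dist N (x y : torus R N) : tdist x y <= l1dist x y.
Proof.
rewrite /tdist -(ger0_norm (l1dist_ge0 _ x y)) -sqrtr_sqr ler_wsqrtr//.
rewrite expr2 {1}/l1dist mulr_suml; apply: ler_sum => i _.
by rewrite expr2 ler_wpM2l ?mdist_ge0// mdist_le_l1dist.
Qed.

Lemma mdist_le_tdist N (x y : torus R N) i : mdist (x 0 i) (y 0 i) <= tdist x y.
Proof.
rewrite -(ger0_norm (mdist_ge0 (x 0 i) (y 0 i))) -sqrtr_sqr ler_wsqrtr//.
rewrite (bigD1 i)//= lerDl; apply: sumr_ge0 => j _; exact: sqr_ge0.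
Qed.

Section positive_dimension.
Context {n : nat}.
Implicit Types (x y : torus R n.+1) (c : circle R).

(** A substitute for the distance to the diagonal, free of infima: the distance to one explicit
    diagonal point. The two are equivalent up to a factor [2 * n.+1]. *)
Definition spread x : R := l1dist x (const_mx (x 0 0)).

Lemma spread_ge0 x : 0 <= spread x.
Proof. exact: l1dist_ge0. Qed.

Lemma mdist_le_spread x i : mdist (x 0 i) (x 0 0) <= spread x.
Proof. by have := mdist_le_l1dist _ x (const_mx (x 0 0)) i; rewrite mxE. Qed.

Lemma spread_const c : spread (const_mx c) = 0.
Proof.
by rewrite /spread /l1dist big1// => i _; rewrite !mxE mdistxx.
Qed.

(** In [n.+2], one unit accounts for the displacements of the coordinates themselves, and [n.+1] for
    that of the reference coordinate, which enters every term. *)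
Lemma spread_lipschitz x y : spread x <= spread y + n.+2%:R * l1dist x y.
Proof.
have -> : n.+2%:R * l1dist x y = l1dist x y + \sum_(i < n.+1) l1dist x y.
  by rewrite sumr_const card_ord mulr_natl -mulrS.
rewrite addrA /spread {1 2 3}/l1dist -!big_split/=; apply: ler_sum => i _; rewrite !mxE.
have := metric_triangle (x 0 i) (y 0 i) (x 0 0).
have := metric_triangle (y 0 i) (y 0 0) (x 0 0).
have := mdist_le_l1dist _ x y 0; rewrite (metric_sym (y 0 0) (x 0 0)).
lra.
Qed.

Lemma sync_diag_const c : sync_diag R n.+1 (const_mx c).
Proof. by exists c => i; rewrite mxE. Qed.

Lemma tdist_set_diag_le_spread x : tdist_set x (sync_diag R n.+1) <= spread x.
Proof.
apply: le_trans (tdist_le_l1dist _ _ _); apply: ge_inf.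
  by exists 0 => _ [y _ <-]; exact: sqrtr_ge0.
by exists (const_mx (x 0 0)) => //; exact: sync_diag_const.
Qed.

(** Each of the [n.+1] terms is at most [2 * tdist x y] for any diagonal [y], by the triangle
    inequality through the common coordinate of [y]. *)
Lemma spread_le_tdist_set_diag x :
  spread x <= 2 * n.+1%:R * tdist_set x (sync_diag R n.+1).
Proof.
have n0 : 0 < 2 * n.+1%:R :> R by rewrite mulr_gt0.
rewrite mulrC -ler_pdivrMr//; apply: lb_le_inf.
  by exists (tdist x (const_mx 0)), (const_mx 0) => //; exact: sync_diag_const.
move=> _ [y [c yc] <-]; rewrite ler_pdivrMr// mulrC -mulrA mulrCA mulr_natl.
rewrite -[X in _ *+ X]card_ord -sumr_const; apply: ler_sum => i _; rewrite mxE.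
have := mdist_le_tdist _ x y i; have := mdist_le_tdist _ x y 0; rewrite !yc.
have := metric_triangle (x 0 i) c (x 0 0); rewrite (metric_sym c (x 0 0)).
lra.
Qed.

(** A tube lemma: the diagonal is the image of the compact segment [[-1, 1]], so one radius works at
    all of its points. *)
Lemma open_diag_spread (U : set (torus R n.+1)) :
  open U -> sync_diag R n.+1 `<=` U ->
  exists2 r : R, 0 < r & forall x, spread x < r -> U x.
Proof.
move=> oU DU.
have cover : near_covering [set` `[(-1 : R), 1]].
  by apply/compact_near_coveringP; exact: segment_compact.
have := cover R (0 : R)^'+ (fun r t => forall x : torus R n.+1,
  (forall i, mdist (cpi t) (x 0 i) < r) -> U x) _.
case=> [t _|r0 /= r0_gt0 Hr].
  have /nbhs_ballP[e /= e0 eU] : nbhs (const_mx (cpi t) : torus R n.+1) U.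
    by apply: open_nbhs_nbhs; split => //; apply: DU; exact: sync_diag_const.
  have e2 : 0 < e / 2 by rewrite divr_gt0.
  exists (ball t (e / 2), [set r | r < e / 2]) => /=.
    by split; [exact: nbhsx_ballx|exact: nbhs_right_lt].
  move=> [u r]/= [tu re] x xu; apply: eU; split => // i j.
  rewrite !ord1 mxE ballEmdist/=.
  have := metric_triangle (cpi t) (cpi u) (x 0 j).
  have := cpi_dist t u; have := xu j; move: tu; rewrite /ball/=; lra.
exists (r0 / 2); first by rewrite divr_gt0.
move=> x xr; apply: (Hr (r0 / 2) _ _ (centered (x 0 0))).
- rewrite /ball/= sub0r normrN gtr0_norm ?divr_gt0//; lra.
- by rewrite divr_gt0.
- have /andP[? ?] := centered_itv (x 0 0).
  by rewrite /= in_itv/=; apply/andP; split; lra.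
- move=> i; rewrite centeredK metric_sym; exact: le_lt_trans (mdist_le_spread x i) xr.
Qed.

(** Passing between [spread] and the distance to the diagonal costs a constant factor, which enough
    iterations of the given contraction absorb. *)
Lemma attracting_diag_spread (G : torus R n.+1 -> torus R n.+1) :
  attracting G (sync_diag R n.+1) ->
  exists (m : nat) (r : R), [/\ (0 < m)%N, 0 < r &
    forall x, spread x < r -> spread (iter m G x) <= spread x / 2].
Proof.
move=> [lam [n0 [U [/andP[lam0 lam1] oU DU GU attr]]]].
have [r r0 rU] := open_diag_spread U oU DU.
have GUx x : U x -> U (G x) by move=> Ux; apply: GU; exists x.
have iterU k x : U x -> U (iter k G x).
  by move=> Ux; elim: k => //= k; exact: GUx.
have tD0 x : 0 <= tdist_set x (sync_diag R n.+1).
  apply: lb_le_inf => [|_ [y _ <-]]; last exact: sqrtr_ge0.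
  by exists (tdist x (const_mx 0)), (const_mx 0) => //; exact: sync_diag_const.
(* If [n0 = 0], then [attr] bounds the distance by [lam] times itself, so it vanishes on all of [U]
   and one iteration suffices. *)
have [n00|n0_gt0] := posnP n0.
  exists 1%N, r; split => // x /rU/GUx Ux /=; apply: (@le_trans _ _ 0).
    apply: le_trans (spread_le_tdist_set_diag _) _.
    have := attr _ Ux; rewrite n00/= => h.
    have := tD0 (G x); set d := tdist_set _ _ in h * => d0.
    have -> : d = 0 by nra.
    by rewrite mulr0.
  by rewrite divr_ge0// spread_ge0.
have attrk k x : U x -> tdist_set (iter (k * n0) G x) (sync_diag R n.+1) <=
    lam ^+ k * tdist_set x (sync_diag R n.+1).
  move=> Ux; elim: k => [|k IH]; first by rewrite expr0 mul1r.
  rewrite mulSn iterD exprS -mulrA (le_trans (attr _ (iterU _ _ Ux)))//.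
  by rewrite ler_wpM2l// ltW.
have [k [k0 lamk]] : exists k, (0 < k)%N /\ 2 * n.+1%:R * lam ^+ k <= 2^-1.
  have N0 : 0 < 2 * n.+1%:R :> R by rewrite mulr_gt0.
  have : geometric (2 * n.+1%:R) lam k @[k --> \oo] --> (0 : R).
    by apply: cvg_geometric; rewrite gtr0_norm.
  move=> /cvgrPdist_le/(_ 2^-1)[|M _ MP]; first by rewrite invr_gt0.
  exists M.+1; split => //; have := MP M.+1 (leqnSn M).
  by rewrite /= sub0r normrN ger0_norm// mulr_ge0 ?exprn_ge0 ?(ltW N0) ?(ltW lam0).
exists (k * n0)%N, r; split; rewrite ?muln_gt0 ?k0// => x /rU Ux.
apply: le_trans (spread_le_tdist_set_diag _) _.
have n1 : 0 <= 2 * n.+1%:R :> R by rewrite mulr_ge0.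
apply: le_trans (ler_wpM2l n1 (attrk k x Ux)) _; rewrite mulrA.
apply: le_trans (ler_wpM2r (tD0 x) lamk) _; rewrite mulrC.
by rewrite ler_wpM2r ?invr_ge0// tdist_set_diag_le_spread.
Qed.

End positive_dimension.

(* The increasing weights turn a contraction of [s] by [iter m G] into a
   contraction of the sum by [G] itself: shifting the orbit by one step lowers
   each weight by 1, and the last term is at most half of the first one. *)
Definition weighted_orbit_sum {T : Type} (G : T -> T) (s : T -> R) (m : nat)
    (x : T) : R :=
  \sum_(j < m) (m + j)%:R * s (iter j G x).

(** The rate comes from the weights: each weight [w] is at most [2m], so
    [w - 1 <= (1 - 1/(2m)) * w]; and the new last term, of weight [2m - 1], is at most
    [(2m - 1)/2 = (1 - 1/(2m)) * m] times [s x]. *)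
Lemma weighted_orbit_sum_contract {T : Type} (G : T -> T) (s : T -> R) m x :
  (0 < m)%N -> (forall x, 0 <= s x) -> s (iter m G x) <= s x / 2 ->
  weighted_orbit_sum G s m (G x) <=
    (1 - (2 * m%:R)^-1) * weighted_orbit_sum G s m x.
Proof.
case: m => // m _ s0 smx; set k := 1 - _.
rewrite /weighted_orbit_sum big_ord_recr big_ord_recl/= addn0 mulrDr addrC.
have m0 : 0 < m.+1%:R :> R by rewrite ltr0n.
have mV : m.+1%:R * m.+1%:R^-1 = 1 :> R by rewrite mulfV// gt_eqF.
have kE : k * m.+1%:R = m.+1%:R - 2^-1.
  by rewrite /k mulrBl mul1r invfM -mulrA mulVf ?mulr1 ?gt_eqF.
apply: lerD.
  rewrite -iterSr mulrA kE (@le_trans _ _ ((m.+1 + m)%:R * (s x / 2)))//.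
    by rewrite ler_wpM2l.
  by rewrite natrD -natr1; have := s0 x; lra.
rewrite mulr_sumr; apply: ler_sum => j _; rewrite -iterSr mulrA ler_wpM2r//.
rewrite /bump/= add1n addnS -natr1 mulrDr mulr1.
have jm : (m.+1 + j)%:R + 1 <= 2 * m.+1%:R :> R.
  by rewrite natr1 -natrM ler_nat mul2n -addnn ltn_add2l ltnS ltnW.
have -> : k * (m.+1 + j)%:R + k = k * ((m.+1 + j)%:R + 1) by rewrite mulrDr mulr1.
by rewrite /k mulrBl mul1r -addrA lerDl subr_ge0 mulrC ler_pdivrMr ?mul1r// mulr_gt0.
Qed.

Lemma lyapunov_diag n (G : torus R n.+1 -> torus R n.+1) (K : R) :
  0 <= K -> (forall x y, l1dist (G x) (G y) <= K * l1dist x y) ->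
  (forall x, sync_diag R n.+1 x -> sync_diag R n.+1 (G x)) ->
  attracting G (sync_diag R n.+1) ->
  exists (V : torus R n.+1 -> R) (k C r : R),
    [/\ 0 < k < 1, 0 <= C & 0 < r] /\
    [/\ forall x, spread x <= V x <= C * spread x,
        forall x y, V x <= V y + C * l1dist x y &
        forall x, spread x < r -> V (G x) <= k * V x].
Proof.
move=> K0 GK GD /attracting_diag_spread[m [r [m0 r0 Gm]]].
(* The [j]-th summand combines the weight, the Lipschitz constant of [spread] and that of the [j]-th
   iterate. *)
pose C := \sum_(j < m) (m + j)%:R * (n.+2%:R * K ^+ j) : R.
have iterK j x y : l1dist (iter j G x) (iter j G y) <= K ^+ j * l1dist x y.
  elim: j => [|j IH]; first by rewrite expr0 mul1r.
  by rewrite !iterS exprS -mulrA (le_trans (GK _ _))// ler_wpM2l.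
have VC x y : weighted_orbit_sum G spread m x <=
    weighted_orbit_sum G spread m y + C * l1dist x y.
  rewrite mulr_suml -big_split/=; apply: ler_sum => j _.
  rewrite -!mulrA -mulrDr ler_wpM2l// (le_trans (spread_lipschitz _ (iter j G y)))//.
  by rewrite lerD2l ler_wpM2l.
have m1 : 1 <= m%:R :> R by rewrite ler1n.
exists (weighted_orbit_sum G spread m), (1 - (2 * m%:R)^-1), C, r.
split; split => //.
- have m2 : 1 < 2 * m%:R :> R by lra.
  have := m2; rewrite -invf_lt1 ?(lt_trans _ m2)// => m3.
  have : 0 < (2 * m%:R)^-1 :> R by rewrite invr_gt0; lra.
  by move=> ?; apply/andP; split; lra.
- by apply: sumr_ge0 => j _; rewrite !mulr_ge0 ?exprn_ge0.
- move=> x; apply/andP; split.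
    case: m m0 m1 {Gm C VC} => // m _ m1.
    rewrite /weighted_orbit_sum big_ord_recl/= addn0 -[leLHS]addr0 lerD//.
      by rewrite ler_peMl// spread_ge0.
    by apply: sumr_ge0 => j _; rewrite mulr_ge0// spread_ge0.
  (* The point [x] is at [l1dist] distance [spread x] from [const_mx (x 0 0)], where the weighted
     sum vanishes because the diagonal is invariant. *)
  apply: le_trans (VC _ (const_mx (x 0 0))) _; rewrite gerDr.
  rewrite /weighted_orbit_sum big1// => j _.
  have : sync_diag R n.+1 (iter j G (const_mx (x 0 0))).
    by elim: {+}(j : nat) => [|i IH]; [exact: sync_diag_const|exact: GD].
  move=> [c yc]; have -> : iter j G (const_mx (x 0 0)) = const_mx c.
    by apply/rowP => i; rewrite yc mxE.
  by rewrite spread_const mulr0.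
- move=> x xr; apply: weighted_orbit_sum_contract => //; last exact: Gm.
  exact: spread_ge0.
Qed.

End torus_spread.

(** * Wasserstein distance to synchronized Dirac states *)

Section wasserstein.
Context {R : realType}.
Implicit Types (mu : prob R) (c : circle R).

Lemma dW_dirac_le mu x c (l s : R) :
  mu (cball x l) = 1%E -> mdist x c <= s -> dW mu (\d_c : prob R) <= l + s.
Proof.
have near_sub (u v w d : R) : `|v - w| <= 0 -> `|u - w| <= d -> u - v <= d.
  by rewrite !ler_norml => /andP[? ?] /andP[? ?]; lra.
move=> mux xc; apply: ge_sup.
  by exists (\int[mu]_x cst 0 x - \int[\d_c]_x cst 0 x)%R, (cst 0) => // y z;
    rewrite subrr normr0 mdist_ge0.
move=> _ [phi phi1 <-].
have int (nu : prob R) : nu.-integrable setT (EFin \o phi).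
  by apply: (lipschitz_integrable nu 1) => // y z; rewrite mul1r phi1.
apply: (near_sub _ _ (phi c)).
  (* The integral against [\d_c] is handled by the same lemma, since the closed ball of radius 0 has
     full mass. *)
  apply: (Rintegral_near _ (cball c 0)) => //; first exact: measurable_cball.
    by rewrite /= diracE mem_set// /cball/= mdistxx.
  by move=> y cy; rewrite distrC (le_trans (phi1 _ _)).
apply: (Rintegral_near _ (cball x l)) => //; first exact: measurable_cball.
move=> y xy; rewrite (le_trans (phi1 _ _))// (le_trans (metric_triangle y x c))//.
by rewrite lerD// metric_sym.
Qed.

Lemma dWmax_ge0 N (mu nu : 'I_N -> prob R) : 0 <= dWmax mu nu.
Proof. exact: bigmax_ge_id. Qed.

Lemma dirac_states_const N c :
  dirac_states (sync_diag R N) (fun=> (\d_c : prob R)).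
Proof.
exists (const_mx c); first by exists c => i; rewrite mxE.
by move=> i A mA; rewrite mxE.
Qed.

Lemma dWmax_set_dirac_states_ge0 N (mu : 'I_N -> prob R) :
  0 <= dWmax_set mu (dirac_states (sync_diag R N)).
Proof.
apply: lb_le_inf => [|_ [nu _ <-]]; last exact: dWmax_ge0.
by eexists; exists (fun=> (\d_(0 : circle R) : prob R)); [exact: dirac_states_const|].
Qed.

Lemma dWmax_set_dirac_states_le N (mu : 'I_N -> prob R) c (b : R) : 0 <= b ->
  (forall i, dW (mu i) (\d_c : prob R) <= b) ->
  dWmax_set mu (dirac_states (sync_diag R N)) <= b.
Proof.
move=> b0 mub; apply: (@le_trans _ _ (dWmax mu (fun=> (\d_c : prob R)))).
  apply: ge_inf; first by exists 0 => _ [nu _ <-]; exact: dWmax_ge0.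
  by exists (fun=> (\d_c : prob R)) => //; exact: dirac_states_const.
exact: bigmax_le.
Qed.

(** Two points of an arc of length less than [e] are within [e]. Any support point may thus serve as
    center, which leaves the freedom to take the centers in [msupp_prod]. *)
Lemma supp_length_cball mu (e : R) : supp_length mu < e ->
  forall x, msupp mu x -> mu (cball x e) = 1%E.
Proof.
move=> /inf_lt[|l [/andP[l0 l1] [a suppl]] le x mux].
  (* The whole circle is an arc of length 1, so the infimum is over a nonempty set. *)
  exists 1; split; first by rewrite ler01 lexx.
  exists 0 => y _; have /andP[y1 y2] := centered_itv y.
  have [y0|y0] := leP 0 (centered y).
    by exists (centered y); rewrite /= ?centeredK// in_itv/=; apply/andP; split; lra.
  exists (centered y + 1); first by rewrite /= in_itv/=; apply/andP; split; lra.
  by rewrite cpiD centeredK (cpi_int 1) addr0.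
apply: (msupp_full _ _ (measurable_cball _ _)) => y muy.
have [t] := suppl _ mux; rewrite /= in_itv/= => /andP[t1 t2] <-.
have [u] := suppl _ muy; rewrite /= in_itv/= => /andP[u1 u2] <-.
rewrite /cball/= (le_trans (cpi_dist _ _))// ler_norml.
by apply/andP; split; lra.
Qed.

End wasserstein.

(** * Mean-field maps of concentrated measures *)

Section mean_field.
Context {R : realType} {n : nat}.
Variables (f : circle R -> circle R) (phi : 'I_n.+1 -> 'I_n.+1 -> circle R -> R).
Variables (L M : R).
Hypothesis L_ge0 : 0 <= L.
Hypothesis f_lip : forall x y, mdist (f x) (f y) <= L * mdist x y.
Hypothesis M_ge0 : 0 <= M.
Hypothesis phi_lip : forall i j x y, `|phi i j x - phi i j y| <= M * mdist x y.
Implicit Types (x y : torus R n.+1) (mu : 'I_n.+1 -> prob R).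

Let N : R := n.+1%:R.

Let ler_sum_const (F : 'I_n.+1 -> R) (b : R) :
  (forall i, F i <= b) -> \sum_i F i <= N * b.
Proof.
by move=> Fb; rewrite mulr_natl -[X in _ *+ X]card_ord -sumr_const ler_sum.
Qed.

Lemma mdistBr (z x y : circle R) : mdist (z - x) (z - y) = mdist x y.
Proof.
by rewrite (metric_sym x y) !mdist_circleE opprB addrC addrA subrK.
Qed.

Lemma mdistBl (z x y : circle R) : mdist (x - z) (y - z) = mdist x y.
Proof. by rewrite !mdist_circleE opprB addrA subrK. Qed.

Lemma mdist_addcpi (x : circle R) (s t : R) : mdist (x + cpi s) (x + cpi t) <= `|s - t|.
Proof.
by rewrite (le_trans (mdist_circleD _ _ _ _))// mdistxx add0r cpi_dist.
Qed.

Lemma coupled_map_lipschitz x y :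
  l1dist (coupled_map f phi x) (coupled_map f phi y) <=
  N * (L * (1 + N * (2 * M))) * l1dist x y.
Proof.
rewrite -mulrA; apply: ler_sum_const => i.
rewrite !mxE (le_trans (f_lip _ _))// -mulrA ler_wpM2l//.
rewrite (le_trans (mdist_circleD _ _ _ _))// mulrDl mul1r.
rewrite lerD ?mdist_le_l1dist// (le_trans (cpi_dist _ _))//.
rewrite -sumrB (le_trans (ler_norm_sum _ _ _))//.
rewrite -mulrA; apply: ler_sum_const => j; rewrite (le_trans (phi_lip _ _ _ _))//.
rewrite (mulrC 2) -mulrA ler_wpM2l//.
have := metric_triangle (x 0 j - x 0 i) (y 0 j - x 0 i) (y 0 j - y 0 i).
rewrite mdistBl mdistBr.
have := mdist_le_l1dist _ x y i; have := mdist_le_l1dist _ x y j; lra.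
Qed.

(** Stated by full mass rather than by supports, so that it passes to push-forwards through an
    inclusion of preimages. *)
Definition concentrated mu x (l : R) : Prop :=
  forall i, mu i (cball (x 0 i) l) = 1%E.

(** The centers are moved by the mean-field maps themselves, not by the coupled map: contraction
    then keeps the image measures in balls around them. *)
Definition mean_field_center mu x : torus R n.+1 :=
  \row_i mean_field_map f phi mu i (x 0 i).

Lemma interaction_integrable (nu : prob R) i j (c : circle R) :
  nu.-integrable setT (EFin \o (fun w => phi i j (w - c))).
Proof.
apply: (lipschitz_integrable nu M _ M_ge0) => y z.
by rewrite (le_trans (phi_lip _ _ _ _))// mdistBl.
Qed.

(** Replacing each [mu j] by the Dirac mass at [x 0 j] turns the mean-field map at the center into
    the coupled map, at a cost of [M * l] per integral. *)
Lemma mean_field_center_close mu x (l : R) : concentrated mu x l ->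
  l1dist (mean_field_center mu x) (coupled_map f phi x) <=
  N * (L * (N * M)) * l.
Proof.
move=> mux; rewrite -mulrA; apply: ler_sum_const => i.
rewrite !mxE (le_trans (f_lip _ _))// -mulrA ler_wpM2l//.
rewrite (le_trans (mdist_addcpi _ _ _))// -sumrB (le_trans (ler_norm_sum _ _ _))//.
rewrite -mulrA; apply: ler_sum_const => j.
apply: (Rintegral_near _ (cball (x 0 j) l)) => //.
- exact: measurable_cball.
- exact: interaction_integrable.
- move=> y; rewrite /cball/= metric_sym => yx.
  by rewrite (le_trans (phi_lip _ _ _ _))// mdistBl ler_wpM2l.
Qed.

(* On the concentration ball, [x + sum_j int phi_ij(y - x) dmu_j(y)] has slope
   close to [1 - sum_j phi_ij'(0)]. *)
Lemma mean_field_map_contract mu x (l e k : R) i :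
  0 <= k -> concentrated mu x l -> 2 * l + 2 * spread x <= e ->
  (forall j (a b : R), `|a| <= e -> `|b| <= e ->
    `|phi i j (cpi b) - phi i j (cpi a) - deriv_real (phi i j) 0 * (b - a)|
      <= k * `|b - a|) ->
  forall y : circle R, mdist (x 0 i) y <= l ->
    mdist (mean_field_map f phi mu i (x 0 i)) (mean_field_map f phi mu i y) <=
    L * (`|1 - \sum_j deriv_real (phi i j) 0| + N * k) * l.
Proof.
move=> k0 mux xe phik y xy; rewrite (le_trans (f_lip _ _))// -mulrA ler_wpM2l//.
pose h := centered (y - x 0 i).
have yE : y = x 0 i + cpi h by rewrite centeredK addrC subrK.
have hl : `|h| <= l by rewrite -mdist_circleE metric_sym.
pose I z := \sum_j (\int[mu j]_w phi i j (w - z))%R.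
(* Moving the base point by [h] shifts every argument of [phi i j] by [- h], hence the sign of the
   linear term. *)
have IE : `|I y - I (x 0 i) + h * \sum_j deriv_real (phi i j) 0| <= N * k * `|h|.
  rewrite -sumrB mulr_sumr -big_split/= (le_trans (ler_norm_sum _ _ _))//.
  rewrite -mulrA; apply: ler_sum_const => j.
  rewrite -RintegralB//; [|exact: interaction_integrable..].
  rewrite -[h * _]opprK; apply: (Rintegral_near _ (cball (x 0 j) l)) => //.
  - exact: measurable_cball.
  - exact: (integrableB _ (interaction_integrable _ _ _ _)
      (interaction_integrable _ _ _ _)).
  (* The lifts [u] of [z - x 0 i] and [u - h] of [z - y] are at most [l + 2 * spread x] and
     [2 * l + 2 * spread x] in absolute value, which is where the hypothesis on [e] enters. *)
  move=> z; rewrite /cball/= => xz; pose u := centered (z - x 0 i).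
  have ul : `|u| <= l + 2 * spread x.
    rewrite -mdist_circleE.
    have := metric_triangle z (x 0 j) (x 0 i); rewrite (metric_sym z (x 0 j)).
    have := metric_triangle (x 0 j) (x 0 0) (x 0 i); rewrite (metric_sym (x 0 0) (x 0 i)).
    by have := mdist_le_spread x i; have := mdist_le_spread x j; lra.
  have -> : z - x 0 i = cpi u by rewrite centeredK.
  have -> : z - y = cpi (u - h).
    by rewrite cpiB !centeredK opprB addrA subrK.
  have l0 : 0 <= l by exact: le_trans (normr_ge0 h) hl.
  have := phik j u (u - h); have -> : u - h - u = - h by ring.
  rewrite normrN mulrN mulrC.
  apply; first by lra.
  by have := ler_normB u h; lra.
have -> : y + cpi (I y) = x 0 i + cpi (h + I y) by rewrite {1}yE -addrA -cpiD.
rewrite (le_trans (mdist_addcpi _ _ _))// -normrN opprB.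
have -> : h + I y - I (x 0 i) = h * (1 - \sum_j deriv_real (phi i j) 0) +
  (I y - I (x 0 i) + h * \sum_j deriv_real (phi i j) 0) by ring.
rewrite (le_trans (ler_normD _ _))// normrM.
rewrite (@le_trans _ _ ((`|1 - \sum_j deriv_real (phi i j) 0| + N * k) * `|h|))//.
  by rewrite [leRHS]mulrDl lerD// mulrC.
by rewrite ler_wpM2l// addr_ge0// mulr_ge0.
Qed.

End mean_field.

(** * One step of the self-consistent operator *)

Section stability.
Context {R : realType} {n : nat}.
Variables (f : circle R -> circle R) (phi : 'I_n.+1 -> 'I_n.+1 -> circle R -> R).
Hypothesis f_C2 : C2_circle f.
Hypothesis phi_C2 : forall i j, C2_real (phi i j).
Hypothesis phi0 : forall i j, phi i j 0 = 0.
Implicit Types (x : torus R n.+1) (mu : 'I_n.+1 -> prob R).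

Let L := sup (range (fun y => `|deriv_circle f y|)).

Lemma interaction_lipschitz :
  exists2 M : R, 0 <= M &
    forall i j y z, `|phi i j y - phi i j z| <= M * mdist y z.
Proof.
have /choice[M HM] (ij : 'I_n.+1 * 'I_n.+1) : exists M : R,
    0 <= M /\ forall y z, `|phi ij.1 ij.2 y - phi ij.1 ij.2 z| <= M * mdist y z.
  by have [M M0 phiM] := C2_real_lipschitz (phi_C2 ij.1 ij.2); exists M.
exists (\sum_ij M ij); first by apply: sumr_ge0 => ij _; have [] := HM ij.
move=> i j y z; have [_ /(_ y z) h] := HM (i, j); apply: le_trans h _.
rewrite ler_wpM2r ?mdist_ge0// (bigD1 (i, j))//= lerDl.
by apply: sumr_ge0 => ij _; have [] := HM ij.
Qed.

Lemma concentrated_self_consistent_op mu x (l l' : R) :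
  concentrated mu x l ->
  (forall i (y : circle R), mdist (x 0 i) y <= l ->
    mdist (mean_field_map f phi mu i (x 0 i)) (mean_field_map f phi mu i y) <= l') ->
  concentrated (self_consistent_op f phi mu) (mean_field_center f phi mu x) l'.
Proof.
move=> mux F i; have mF := measurable_mean_field_map mu i f_C2 phi_C2.
rewrite /self_consistent_op transferE// mxE.
have mA : measurable (mean_field_map f phi mu i @^-1`
    cball (mean_field_map f phi mu i (x 0 i)) l').
  by rewrite -[_ @^-1` _]setTI; apply: (mF measurableT); exact: measurable_cball.
apply/eqP; rewrite eq_le probability_le1//= -(mux i) le_measure ?inE//.
  exact: measurable_cball.
by move=> y /F.
Qed.

Lemma coupled_map_sync_diag x :
  sync_diag R n.+1 x -> sync_diag R n.+1 (coupled_map f phi x).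
Proof.
move=> [c xc]; exists (f c) => i; rewrite mxE big1 ?cpi0 ?addr0 ?xc// => j _.
by rewrite !xc subrr phi0.
Qed.

Hypothesis contraction : forall i : 'I_n.+1,
  L * `|1 - \sum_(j < n.+1) deriv_real (phi i j) 0| < 1.

Lemma uniform_contraction : exists t k : R, [/\ 0 < t < 1, 0 < k &
  forall i, L * (`|1 - \sum_(j < n.+1) deriv_real (phi i j) 0| + n.+1%:R * k) <= t].
Proof.
pose c := \big[Num.max/0]_i (L * `|1 - \sum_(j < n.+1) deriv_real (phi i j) 0|).
have c0 : 0 <= c by exact: bigmax_ge_id.
have c1 : c < 1 by apply: bigmax_lt.
have L0 : 0 <= L by exact: sup_deriv_circle_ge0.
have LN : 0 < (L + 1) * n.+1%:R by rewrite mulr_gt0// ltr_wpDl.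
(* Half of the gap [1 - c] is left to the linearization error; [L + 1] avoids a division by zero
   when [L = 0]. *)
exists ((1 + c) / 2), ((1 - c) / 2 / ((L + 1) * n.+1%:R)); split.
- by apply/andP; split; lra.
- by rewrite !divr_gt0// subr_gt0.
move=> i; have ci := le_bigmax 0
  (fun i => L * `|1 - \sum_(j < n.+1) deriv_real (phi i j) 0|) i.
have : L * (n.+1%:R * ((1 - c) / 2 / ((L + 1) * n.+1%:R))) <= (1 - c) / 2.
  have -> : L * (n.+1%:R * ((1 - c) / 2 / ((L + 1) * n.+1%:R))) =
      L / (L + 1) * ((1 - c) / 2).
    by field; rewrite !gt_eqF// ltr_wpDl.
  rewrite ler_piMl//; first by rewrite divr_ge0// subr_ge0 ltW.
  by rewrite ler_pdivrMr ?mul1r ?lerDl// ltr_wpDl.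
by move=> h; rewrite mulrDr (le_trans (lerD ci h))// -/c; lra.
Qed.

Lemma self_consistent_op_contract :
  attracting (coupled_map f phi) (sync_diag R n.+1) ->
  exists (V : torus R n.+1 -> R) (q B C d : R),
    [/\ 0 < q < 1, 1 <= B, 0 <= C & 0 < d] /\
    [/\ forall x, spread x <= V x <= C * spread x &
      forall mu x l, 0 <= l -> concentrated mu x l -> V x + B * l < d ->
        exists x' l', [/\ 0 <= l', concentrated (self_consistent_op f phi mu) x' l'
          & V x' + B * l' <= q * (V x + B * l)]].
Proof.
have L0 : 0 <= L by exact: sup_deriv_circle_ge0.
have f_lip := C2_circle_lipschitz f f_C2; rewrite -/L in f_lip.
have [M M0 phi_lip] := interaction_lipschitz.
have [t [k [/andP[t0 t1] k0 Lt]]] := uniform_contraction.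
have [e [e0 phik]] : exists e : R, 0 < e /\ forall i j (a b : R),
    `|a| <= e -> `|b| <= e ->
    `|phi i j (cpi b) - phi i j (cpi a) - deriv_real (phi i j) 0 * (b - a)|
      <= k * `|b - a|.
  have := @filter_ex _ (0 : R)^'+ _ _ (filterI (nbhs_right_gt 0) (filter_forall _
    (fun i => filter_forall _ (fun j => C2_real_near0 (phi i j) k (phi_C2 i j) k0)))).
  by move=> [e [e0 He]]; exists e.
have GK := coupled_map_lipschitz f phi L M L0 f_lip M0 phi_lip.
move=> attr; have [|V [kV [C [r [[/andP[kV0 kV1] C0 r0] [sV VC Vk]]]]]] :=
  lyapunov_diag n (coupled_map f phi) _ _ GK coupled_map_sync_diag attr.
  by rewrite !mulr_ge0// addr_ge0// !mulr_ge0.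
pose D := n.+1%:R * (L * (n.+1%:R * M)).
have D0 : 0 <= D by rewrite !mulr_ge0.
have CD0 : 0 <= C * D by rewrite mulr_ge0.
have t1' : 0 < 1 - t by rewrite subr_gt0.
(* Chosen so that [C * D + B * t <= B * (1 + t) / 2]: half of the decay of [B * l] pays for the
   error [C * D * l] in [V]. The added 1 also ensures [1 <= B]. *)
pose B := 2 * (C * D + 1) / (1 - t).
have BE : B * (1 - t) = 2 * (C * D + 1) by rewrite /B divfK// gt_eqF.
have B1 : 1 <= B by rewrite /B ler_pdivlMr//; lra.
pose q := Num.max kV ((1 + t) / 2).
have kVq : kV <= q by rewrite le_max lexx.
have tq : (1 + t) / 2 <= q by rewrite le_max lexx orbT.
(* As [V x + B * l] dominates [spread x + l], the threshold [r] gives the decay of [V], and [e / 2]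
   the validity of the linearization. *)
exists V, q, B, C, (Num.min r (e / 2)); split; split => //.
- by rewrite lt_max kV0 gt_max kV1/=; lra.
- by rewrite lt_min r0 divr_gt0.
move=> mu x l l0 mux; rewrite lt_min => /andP[Qr Qe].
have /andP[sx _] := sV x; have s0 := spread_ge0 x.
have lB : l <= B * l by rewrite ler_peMl.
have sr : spread x < r by lra.
have sle : 2 * l + 2 * spread x <= e by lra.
have Vx : V (mean_field_center f phi mu x) <= kV * V x + C * D * l.
  apply: le_trans (VC _ (coupled_map f phi x)) _.
  rewrite lerD ?Vk// -mulrA ler_wpM2l//.
  exact: (mean_field_center_close f phi L M L0 f_lip M0 phi_lip).
exists (mean_field_center f phi mu x), (t * l); split.
- by rewrite mulr_ge0// ltW.
- apply: (concentrated_self_consistent_op _ _ _ _ mux) => i y xy.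
  apply: le_trans (mean_field_map_contract f phi L M L0 f_lip M0 phi_lip mu x l e k i
    (ltW k0) mux sle (phik i) y xy) _.
  by rewrite ler_wpM2r.
- have V0 : 0 <= V x by lra.
  have h1 : kV * V x <= q * V x by rewrite ler_wpM2r.
  have h2 : C * D * l + B * (t * l) <= (1 + t) / 2 * (B * l).
    have : 0 <= (B * (1 - t) / 2 - C * D) * l by rewrite mulr_ge0// BE; lra.
    lra.
  have h3 : (1 + t) / 2 * (B * l) <= q * (B * l).
    by rewrite ler_wpM2r// (le_trans l0).
  lra.
Qed.

End stability.

(** * Convergence of orbits to the synchronized states *)

Theorem proposition3p2 (R : realType) (N : nat)
    (f : circle R -> circle R) (phi : 'I_N -> 'I_N -> circle R -> R)
    (f_C2 : C2_circle f)
    (phi_C2 : forall i j, C2_real (phi i j))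
    (phi0 : forall i j, phi i j 0 = 0)
    (dphi0 : forall i j, 0 < deriv_real (phi i j) 0)
    (Delta_attracting : attracting (coupled_map f phi) (sync_diag R N))
    (contraction : forall i : 'I_N,
      sup (range (fun x => `|deriv_circle f x|)) *
        `|1 - \sum_(j < N) deriv_real (phi i j) 0| < 1) :
  stable (self_consistent_op f phi) (sync_diag R N).
Proof.
case: N phi phi_C2 phi0 {dphi0} Delta_attracting contraction
  => [|n] phi phi_C2 phi0 attr contr.
  (* For [N = 0] the empty maximum has the default value 0, so the sequence is constantly 0. *)
  exists 1, 1; split => // mu _ _.
  rewrite (_ : (fun k => _) = cst 0); first exact: cvg_cst.
  apply/funext => k; apply/eqP; rewrite eq_le dWmax_set_dirac_states_ge0 andbT.
  by apply: (dWmax_set_dirac_states_le _ _ 0) => // -[].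
have [V [q [B [C [d [[/andP[q0 q1] B1 C0 d0] [sV step]]]]]]] :=
  self_consistent_op_contract f phi f_C2 phi_C2 phi0 contr attr.
have B0 : 0 < B by lra.
have CN0 : 0 < 2 * n.+1%:R * (C + 1) by rewrite !mulr_gt0//; lra.
(* Each radius keeps one of the two terms of [V x + B * l] within [d / 2]; [C + 1] is positive even
   if [C = 0]. *)
exists (d / 2 / B), (d / 2 / (2 * n.+1%:R * (C + 1))); split.
- by rewrite !divr_gt0.
- by rewrite !divr_gt0.
move=> mu mulen musupp.
have /choice[c suppc] (i : 'I_n.+1) : exists c, msupp (mu i) c.
  exact: msupp_nonempty.
pose x : torus R n.+1 := \row_i c i.
have e0 : 0 <= d / 2 / B by rewrite !divr_ge0// ltW.
have mux : concentrated mu x (d / 2 / B).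
  move=> i; rewrite mxE; apply: supp_length_cball => //.
  apply: le_lt_trans mulen; exact: (le_bigmax 0 (fun i => supp_length (mu i))).
have Qx : V x + B * (d / 2 / B) < d.
  have -> : B * (d / 2 / B) = d / 2 by field; rewrite gt_eqF.
  have /musupp : msupp_prod mu x by move=> i; rewrite mxE.
  rewrite /nbhd/= ltr_pdivlMr// => tx.
  have /andP[_ Vx] := sV x.
  have sx := spread_le_tdist_set_diag x; have s0 := spread_ge0 x.
  have : C * spread x <= tdist_set x (sync_diag R n.+1) * (2 * n.+1%:R * (C + 1)).
    have -> : forall T : R, T * (2 * n.+1%:R * (C + 1)) = (C + 1) * (2 * n.+1%:R * T).
      by move=> T; ring.
    by apply: ler_pM => //; lra.
  lra.
(* Since [q ^+ k <= 1], the quantity stays below [d], so the one-step estimate applies again. *)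
have orbit k : exists y l, [/\ 0 <= l,
    concentrated (iter k (self_consistent_op f phi) mu) y l &
    V y + B * l <= q ^+ k * (V x + B * (d / 2 / B))].
  elim: k => [|k [y [l [l0 muy Qy]]]].
    by exists x, (d / 2 / B); rewrite expr0 mul1r.
  have Q0 : 0 <= V x + B * (d / 2 / B).
    have /andP[Vx _] := sV x; rewrite addr_ge0 ?(le_trans _ Vx) ?spread_ge0//.
    by rewrite mulr_ge0// ltW.
  have [|y' [l' [l'0 muy' Qy']]] := step _ y l l0 muy.
    apply: le_lt_trans Qx; apply: le_trans Qy _.
    by rewrite ler_piMl// exprn_ile1// ltW.
  exists y', l'; split => //; apply: le_trans Qy' _.
  by rewrite exprS -mulrA ler_wpM2l// ltW.
apply: (@squeeze_cvgr _ _ _ _ (cst 0) (geometric (V x + B * (d / 2 / B)) q)).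
- near=> k; rewrite dWmax_set_dirac_states_ge0/=.
  have [y [l [l0 muy Qy]]] := orbit k.
  rewrite mulrC; apply: le_trans Qy; have /andP[sy _] := sV y.
  have ly : l <= B * l by rewrite ler_peMl.
  have s0 := spread_ge0 y.
  (* All components are compared with the Dirac mass at the single point [y 0 0]; the error
     [l + spread y] is at most [V y + B * l]. *)
  apply: (dWmax_set_dirac_states_le _ _ (y 0 0)) => [|i]; first by lra.
  apply: le_trans (dW_dirac_le _ _ _ _ _ (muy i) (mdist_le_spread y i)) _.
  by rewrite addrC lerD.
- exact: cvg_cst.
- by apply: cvg_geometric; rewrite gtr0_norm.
Unshelve. all: by end_near. Qed.
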